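(* Let $q$ be a prime power, $\Delta$ an $n\times n$ diagonal matrix over $\mathbb{F}_q$ with distinct diagonal entries $\delta_1,\dots,\delta_n$, and $\mu=(\mu_1,\dots,\mu_k)$ a partition with positive parts. Let $C\subseteq[n]$ with $|C|=\mu_1$, and let $\Delta'$ be the $(n-\mu_1)\times(n-\mu_1)$ diagonal matrix whose diagonal entries are $\delta_t$ for $t\in[n]\setminus C$, in increasing order of $t$. Then $$\sigma^C_n(\mu)=(q-1)^{\mu_2}q^{\binom{\mu_2}{2}}\sum_D c_q(T(C,D))\,\sigma'^{D}_{n-\mu_1}((\mu_2,\dots,\mu_k)),$$ the sum over all $D\subseteq[n-\mu_1]$ with $|D|=\mu_2$ such that $T(C,D)$ is a multilinear tableau. Here $\sigma^C_n(\mu)$ is the number of subspaces of $\mathbb{F}_q^n$ with pivots $C$ and $\Delta$-profile $\mu$, and $\sigma'^D_{n-\mu_1}(\nu)$ is the number of subspaces of $\mathbb{F}_q^{n-\mu_1}$ with pivots $D$ and $\Delta'$-profile $\nu$ (with $\mu_2=0$ and $\nu$ empty if $k=1$).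
   Context: $W$ has $\Delta$-profile $\mu$ if $\dim(W+\Delta W+\dots+\Delta^{j-1}W)=\mu_1+\dots+\mu_j$ for $1\le j\le k$ and $\dim(W+\dots+\Delta^{k-1}W)=\dim(W+\dots+\Delta^kW)$. A subspace $W$ of dimension $m$ has pivots $C=(c_1<\dots<c_m)$ if its basis in reduced row echelon form has leading $1$ of row $i$ in column $c_i$. Let $\phi_C:[n-\mu_1]\to[n]\setminus C$ be the order-preserving bijection; $T(C,D)$ is the two-column array whose first column is $C$ and second column is $\phi_C(D)$, both in increasing order top to bottom. A multilinear tableau is an array of distinct positive integers with rows increasing left to right and columns increasing top to bottom. For a multilinear tableau $T$ of shape $(\lambda_1,\dots,\lambda_r)$ and $2\le j\le\lambda_i$, $c_{ij}(T)=\#\{i'\ge i:\text{cell }(i',j-1)\text{ exists and }T_{i',j-1}<T_{ij}\}$, $c_q(T)=\prod_i\prod_{j=2}^{\lambda_i}[c_{ij}(T)]_q$ with $[a]_q=1+q+\dots+q^{a-1}$. *)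

(* Defs.v *)
From HB Require Import structures.
From mathcomp Require Import all_boot all_order all_algebra.

Set Implicit Arguments.
Unset Strict Implicit.
Unset Printing Implicit Defensive.

Local Open Scope nat_scope.

(* [a]_q = 1 + q + ... + q^(a-1) *)
Definition qint (q a : nat) : nat := \sum_(i < a) q ^ i.

(* An array is given by the sequence of its columns, each one listed from top
   to bottom; all columns start in the first row.  Rows, columns and cells are
   numbered from 0, the entries themselves are not shifted. *)
Definition array := seq (seq nat).

Definition tcol (T : array) (j : nat) : seq nat := nth [::] T j.
Definition has_cell (T : array) (i j : nat) : bool := i < size (tcol T j).
Definition entry (T : array) (i j : nat) : nat := nth 0 (tcol T j) i.
Definition nrows (T : array) : nat := \max_(c <- T) size c.
Definition trow (T : array) (i : nat) : seq nat :=
  [seq nth 0 c i | c <- T & i < size c].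

(* The first condition says that the shape (size (trow T 0), size (trow T 1), ...)
   is a partition, i.e. that the rows are left-justified. *)
Definition multilinear_tableau (T : array) : bool :=
  [&& sorted geq (shape T),
      all (fun x => 0 < x) (flatten T),
      uniq (flatten T),
      all (fun i => sorted ltn (trow T i)) (iota 0 (nrows T))
    & all (sorted ltn) T].

Definition c_stat (T : array) (i j : nat) : nat :=
  count (fun i' => has_cell T i' j.-1 && (entry T i' j.-1 < entry T i j))
        (index_iota i (nrows T)).

Definition cq (q : nat) (T : array) : nat :=
  \prod_(0 <= i < nrows T) \prod_(1 <= j < size (trow T i)) qint q (c_stat T i j).

Lemma ltn_enum_val n (A : {set 'I_n}) (i j : 'I_#|A|) :
  i < j -> enum_val i < enum_val j.
Proof.
have srt : sorted (fun x y : 'I_n => x < y) (enum A).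
  rewrite /enum_mem; apply: sorted_filter; first by move=> x y z; apply: ltn_trans.
  have := iota_ltn_sorted 0 n.
  by rewrite -val_enum_ord sorted_map enumT.
move=> ltij; have x0 := enum_val i; rewrite !(enum_val_nth x0).
by apply: (sorted_ltn_nth _ _ srt); rewrite ?inE -?cardE //; apply: ltn_trans.
Qed.

Lemma card_setC_ord n (C : {set 'I_n}) : n - #|C| = #|~: C|.
Proof. by rewrite [RHS]cardsCs setCK card_ord. Qed.

(* The order-preserving bijection [n - #|C|] -> [n] \ C; see phiP below. *)
Definition phi n (C : {set 'I_n}) (t : 'I_(n - #|C|)) : 'I_n :=
  enum_val (cast_ord (card_setC_ord C) t).

Lemma phiP n (C : {set 'I_n}) :
  {homo @phi n C : s t / s < t} /\ @phi n C @: setT = ~: C.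
Proof.
split=> [s t lt_st|]; first exact: ltn_enum_val.
apply/setP=> x; apply/imsetP/idP=> [[t _ ->]|xC]; first exact: enum_valP.
exists (cast_ord (esym (card_setC_ord C)) (enum_rank_in xC x)) => //.
by rewrite /phi cast_ordKV enum_rankK_in.
Qed.

(* Elements of {1, ..., n} are encoded by 'I_n = {0, ..., n-1}; enum lists them
   in increasing order, and the shift by one restores the original labels. *)
Definition labels n (A : {set 'I_n}) : seq nat := [seq (val x).+1 | x <- enum A].

Definition TCD n (C : {set 'I_n}) (D : {set 'I_(n - #|C|)}) : array :=
  [:: labels C; labels (@phi n C @: D)].

Local Open Scope ring_scope.

Section Subspaces.
Variables (F : finFieldType) (n : nat).

(* A subspace of F^n is represented by the unique n x n matrix W with
   <<W>>%MS = W whose row space it is; Delta acts by W |-> W *m Delta. *)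
Definition subspaces : {set 'M[F]_n} := [set W | <<W>>%MS == W].

(* B is in reduced row echelon form without zero rows, and the leading 1 of
   its row i is in column c i. *)
Definition rref_with_pivots m (B : 'M[F]_(m, n)) (c : 'I_m -> 'I_n) : bool :=
  [&& [forall i : 'I_m, forall i' : 'I_m, (i < i')%N ==> (c i < c i')%N],
      [forall i, forall j : 'I_n, (j < c i)%N ==> (B i j == 0)]
    & [forall i, forall i', B i' (c i) == (i' == i)%:R]].

Definition has_pivots (W : 'M[F]_n) (C : {set 'I_n}) : bool :=
  [exists B : 'M[F]_(#|C|, n),
     rref_with_pivots B (fun i => enum_val i) && (B == W)%MS].

Definition krylov_dim (Delta W : 'M[F]_n) (j : nat) : nat :=
  \rank (\sum_(i < j) W *m Delta ^+ i)%MS.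

(* For mu = [::] the second condition reads 0 = \rank W. *)
Definition has_profile (Delta : 'M[F]_n) (mu : seq nat) (W : 'M[F]_n) : bool :=
  [forall j : 'I_(size mu), krylov_dim Delta W j.+1 == sumn (take j.+1 mu)]
  && (krylov_dim Delta W (size mu) == krylov_dim Delta W (size mu).+1).

Definition sigma (Delta : 'M[F]_n) (C : {set 'I_n}) (mu : seq nat) : nat :=
  #|[set W in subspaces | has_pivots W C && has_profile Delta mu W]|.

End Subspaces.

(* Main.v *)
Require Import Defs.
From HB Require Import structures.
From mathcomp Require Import all_boot all_order all_algebra.

(* After permuting columns, the reduced echelon basis of a subspace W with
   pivots C is [I | X].  Subtracting Delta_C [I | X] from [I | X] Delta leaves
   [0 | Y] with Y i t = (delta_(phi t) - delta_(c_i)) X i t; as the delta's are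
   distinct, X <-> Y is a bijection preserving the support condition
   "Y i t = 0 if phi t < c_i".  The Krylov spaces of W are W plus those of the
   row space V of Y under Delta', so W has profile mu iff V has profile
   (mu_2, ..., mu_k).  If R is the reduced echelon basis of V, with pivots D,
   then Y = A R with A of full column rank, and the support condition on Y
   becomes "A i j = 0 if phi d_j < c_i".  The j-th column of A (from 0) thus has
   h_j free entries, h_0 <= h_1 <= ..., which gives prod_j (q^h_j - q^j)
   matrices A.  Finally T(C, D) is a multilinear tableau iff j < h_j for all j,
   and its statistics in the second column are the h_j - j. *)

Set Implicit Arguments.
Unset Strict Implicit.
Unset Printing Implicit Defensive.

Import GRing.Theory.
Local Open Scope ring_scope.

(** * Matrices that extract or insert columns *)

Section Selection.
Variables (F : fieldType) (m n : nat) (f : 'I_m -> 'I_n).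

(** Right multiplication by the transpose extracts the columns [f t]; for injective [f], right
    multiplication by [sel_mx] puts columns back at these places and zeros elsewhere. *)
Definition sel_mx : 'M[F]_(m, n) := \matrix_(i, x) (x == f i)%:R.

Lemma mul_tr_sel_mxE p (M : 'M[F]_(p, n)) i t : (M *m sel_mx^T) i t = M i (f t).
Proof.
rewrite mxE (bigD1 (f t)) //= big1 ?addr0 => [|x xft].
  by rewrite !mxE eqxx mulr1.
by rewrite !mxE (negPf xft) mulr0.
Qed.

Lemma mul_sel_mxE p (M : 'M[F]_(p, m)) i t : injective f ->
  (M *m sel_mx) i (f t) = M i t.
Proof.
move=> f_inj; rewrite mxE (bigD1 t) //= big1 ?addr0 => [|x xt].
  by rewrite !mxE eqxx mulr1.
by rewrite !mxE inj_eq // eq_sym (negPf xt) mulr0.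
Qed.

Lemma mul_sel_mx_out p (M : 'M[F]_(p, m)) i x : (forall t, x != f t) ->
  (M *m sel_mx) i x = 0.
Proof.
by move=> xf; rewrite mxE big1 // => t _; rewrite !mxE (negPf (xf t)) mulr0.
Qed.

Lemma sel_mx_mul_tr : injective f -> sel_mx *m sel_mx^T = 1%:M.
Proof.
move=> f_inj; apply/matrixP=> i j.
by rewrite mul_tr_sel_mxE !mxE inj_eq // eq_sym.
Qed.

Lemma row_free_sel_mx : injective f -> row_free sel_mx.
Proof. by move=> f_inj; apply/row_freeP; exists sel_mx^T; apply: sel_mx_mul_tr. Qed.

Lemma sel_mx_diag (d : 'rV[F]_n) :
  sel_mx *m diag_mx d = diag_mx (\row_t d 0 (f t)) *m sel_mx.
Proof.
apply/matrixP=> i x; rewrite mul_mx_diag mul_diag_mx !mxE.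
by case: eqP => [->|_]; rewrite ?mulr1 ?mul1r ?mulr0 ?mul0r.
Qed.

End Selection.

(** * Increasing enumerations of a set of columns and of its complement *)

Section OrdinalSets.
Variables (n : nat).
Implicit Types (A C : {set 'I_n}).

Lemma ltn_enum_valE A (i j : 'I_#|A|) : (enum_val i < enum_val j)%N = (i < j)%N.
Proof.
case: (ltngtP i j) => [ltij|ltji|/val_inj ->]; last by rewrite ltnn.
  exact: ltn_enum_val.
by apply/negbTE; rewrite -leqNgt ltnW // ltn_enum_val.
Qed.

Lemma phi_inj C : injective (@phi n C).
Proof. by move=> s t /enum_val_inj /cast_ord_inj. Qed.

Lemma phi_notin C t : @phi n C t \notin C.
Proof. by have := enum_valP (cast_ord (card_setC_ord C) t); rewrite inE. Qed.

Lemma phi_surj C x : x \notin C -> exists t, x = @phi n C t.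
Proof.
rewrite -in_setC -(proj2 (phiP C)) => /imsetP[t _ ->]; by exists t.
Qed.

Lemma ltn_phiE C s t : (@phi n C s < @phi n C t)%N = (s < t)%N.
Proof.
have [phi_homo _] := phiP C.
case: (ltngtP s t) => [ltst|ltts|/val_inj ->]; last by rewrite ltnn.
  exact: phi_homo.
by apply/negbTE; rewrite -leqNgt ltnW // phi_homo.
Qed.

Lemma enum_val_surj A x : x \in A -> exists i : 'I_#|A|, x = enum_val i.
Proof. by move=> Ax; exists (enum_rank_in Ax x); rewrite enum_rankK_in. Qed.

Lemma enum_val_neq_phi C (i : 'I_#|C|) t : (enum_val i == @phi n C t) = false.
Proof.
apply/eqP=> eq_it; have := enum_valP i; rewrite eq_it.
by rewrite (negPf (phi_notin t)).
Qed.

Lemma ltn_phi_enum_val C (i : 'I_#|C|) t :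
  (@phi n C t < enum_val i)%N = ~~ (enum_val i < @phi n C t)%N.
Proof.
by case: ltngtP => // /val_inj /esym/eqP; rewrite enum_val_neq_phi.
Qed.

End OrdinalSets.

(** * Reduced row echelon form: existence, uniqueness, pivots *)

Definition piv_mx (F : fieldType) n (D : {set 'I_n}) : 'M[F]_(#|D|, n) :=
  sel_mx F (fun i => enum_val i).

Lemma mul_tr_piv_mxE (F : fieldType) n (D : {set 'I_n}) p (M : 'M[F]_(p, n)) i j :
  (M *m (piv_mx F D)^T) i j = M i (enum_val j).
Proof. exact: mul_tr_sel_mxE. Qed.

Section Rref.
Variables (F : fieldType) (n : nat).
Implicit Type D : {set 'I_n}.


(** The pivot condition is a matrix equation, so that multiplying a combination of the rows of [B]
    by [(piv_mx F D)^T] recovers its coefficients. *)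
Definition rref (D : {set 'I_n}) (B : 'M[F]_(#|D|, n)) :=
  (forall (i : 'I_#|D|) (j : 'I_n), (j < enum_val i)%N -> B i j = 0)
  /\ B *m (piv_mx F D)^T = 1%:M.

(** If [B = M *m B'], the pivot columns of both sides show that [M] is the identity. *)
Lemma rref_inj D (B B' : 'M[F]_(#|D|, n)) :
  rref B -> rref B' -> (B <= B')%MS -> B = B'.
Proof.
move=> [_ B1] [_ B'1] /submxP[M defB]; move: B1.
by rewrite defB -mulmxA B'1 mulmx1 => ->; rewrite mul1mx.
Qed.

Lemma rref_row_free D (B : 'M[F]_(#|D|, n)) : rref B -> row_free B.
Proof. by case=> _ B1; apply/row_freeP; exists (piv_mx F D)^T. Qed.

Definition leading (v : 'rV[F]_n) (t : 'I_n) :=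
  (v 0 t != 0) && [forall s : 'I_n, (s < t)%N ==> (v 0 s == 0)].

Lemma leadingP (v : 'rV[F]_n) t :
  reflect (v 0 t != 0 /\ forall s : 'I_n, (s < t)%N -> v 0 s = 0) (leading v t).
Proof.
apply: (iffP andP) => -[vt v0]; split=> //.
  by move=> s lt_st; apply/eqP; move: lt_st; apply/implyP; apply: (forallP v0).
by apply/forallP=> s; apply/implyP=> lt_st; rewrite v0.
Qed.

Lemma ex_leading (v : 'rV[F]_n) : v != 0 -> exists t, leading v t.
Proof.
case/rV0Pn=> t0 vt0; have [t vt tmin] := @arg_minnP _ t0 (fun t => v 0 t != 0) val vt0.
exists t; apply/leadingP; split=> // s lt_st; apply/eqP; apply: contraLR lt_st.
by rewrite -leqNgt; apply: tmin.
Qed.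

End Rref.

Section FiniteRref.
Variables (F : finFieldType) (n : nat).


Lemma rrefP (D : {set 'I_n}) (B : 'M[F]_(#|D|, n)) :
  reflect (rref B) (rref_with_pivots B (fun i => enum_val i)).
Proof.
apply: (iffP and3P) => [[_ /forallP B0 /forallP B1]|[B0 B1]].
  split=> [i j lt_ji|].
    by have /forallP/(_ j) := B0 i; rewrite lt_ji => /eqP.
  apply/matrixP=> i j; rewrite mul_tr_piv_mxE mxE.
  by have /forallP/(_ i)/eqP := B1 j.
split.
- by do 2 apply/forallP=> ?; apply/implyP; apply: ltn_enum_val.
- by apply/forallP=> i; apply/forallP=> j; apply/implyP=> lt_ji; rewrite B0.
apply/forallP=> i; apply/forallP=> j.
by rewrite -mul_tr_piv_mxE B1 mxE.
Qed.

(** A description of the pivot columns that refers to the row space only, not to a basis. *)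
Definition lead_set m (V : 'M[F]_(m, n)) : {set 'I_n} :=
  [set t | [exists v : 'rV[F]_n, (v <= V)%MS && leading v t]].

Lemma lead_setP m (V : 'M[F]_(m, n)) t :
  reflect (exists2 v : 'rV[F]_n, (v <= V)%MS & leading v t) (t \in lead_set V).
Proof. by rewrite inE; apply: (iffP existsP) => -[v]; [case/andP|]; exists v => //; apply/andP. Qed.

Lemma eq_lead_set m1 m2 (V1 : 'M[F]_(m1, n)) (V2 : 'M[F]_(m2, n)) :
  (V1 :=: V2)%MS -> lead_set V1 = lead_set V2.
Proof. by move=> eqV; apply/setP=> t; rewrite !inE; apply: eq_existsb => v; rewrite eqV. Qed.

(** The coefficients of a combination of rows are its entries at the pivots, so it leads at the
    pivot of the first row with nonzero coefficient. Conversely each row leads at its own pivot. *)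
Lemma rref_lead_set (D : {set 'I_n}) (B : 'M[F]_(#|D|, n)) :
  rref B -> lead_set B = D.
Proof.
move=> [B0 B1]; have BE i j : B i (enum_val j) = (i == j)%:R.
  by rewrite -mul_tr_piv_mxE B1 mxE.
apply/setP=> t; apply/lead_setP/idP=> [[v /submxP[a defv] /leadingP[vt v0]]|Dt].
  have aE i : a 0 i = v 0 (enum_val i).
    by rewrite -mul_tr_piv_mxE defv -mulmxA B1 mulmx1.
  have a_neq0 : a != 0.
    by apply: contraNneq vt => a0; rewrite defv a0 mul0mx mxE.
  have [i /leadingP[ai ai0]] := ex_leading a_neq0.
  have le_ti : (t <= enum_val i)%N.
    by rewrite leqNgt; apply: contraNN ai => /v0; rewrite aE => ->.
  have [lt_ti|ge_ti] := ltnP t (enum_val i); last first.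
    by rewrite (_ : t = enum_val i) ?enum_valP //; apply/val_inj/eqP; rewrite eqn_leq le_ti.
  (* Before the pivot of row [i] the entry of [v] is zero: rows above [i] have coefficient 0, and
     rows from [i] on have not started yet. *)
  case/eqP: vt; rewrite defv mxE big1 // => j _.
  have [/ai0->|le_ij] := ltnP j i; first by rewrite mul0r.
  rewrite B0 ?mulr0 //; apply: leq_trans lt_ti _.
  by rewrite leqNgt ltn_enum_valE -leqNgt.
have [i ->] := enum_val_surj Dt.
exists (row i B); first exact: row_sub.
apply/leadingP; split=> [|s lt_s]; rewrite mxE ?BE ?eqxx ?oner_eq0 //.
exact: B0.
Qed.

(* The pivot columns are the positions of leading entries of vectors of V:
   a vector of V vanishing there is zero, and vectors with these leading
   positions restrict to an invertible triangular matrix. *)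
Lemma ex_rref m (V : 'M[F]_(m, n)) :
  exists2 B : 'M[F]_(#|lead_set V|, n), rref B & (B :=: V)%MS.
Proof.
set D := lead_set V; pose S := piv_mx F D.
have V0 (v : 'rV_n) : (v <= V)%MS -> v *m S^T = 0 -> v = 0.
  move=> vV vS; apply/eqP; apply: contraT => /ex_leading[t vt].
  have Dt : t \in D by apply/lead_setP; exists v.
  have [i deft] := enum_val_surj Dt; case/leadingP: vt.
  by rewrite deft -mul_tr_piv_mxE vS mxE eqxx.
have exv (i : 'I_#|D|) : {v : 'rV[F]_n | (v <= V)%MS && leading v (enum_val i)}.
  by apply: sigW; case/lead_setP: (enum_valP i) => v vV vi; exists v; rewrite vV.
pose P : 'M_(#|D|, n) := \matrix_i sval (exv i).
have PE i : row i P = sval (exv i) by rewrite rowK.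
have PV : (P <= V)%MS by apply/row_subP=> i; rewrite PE; case/andP: (svalP (exv i)).
have PS_unit : P *m S^T \in unitmx.
  have PSE i j : (P *m S^T) i j = sval (exv i) 0 (enum_val j).
    by rewrite mul_tr_piv_mxE -PE [RHS]mxE.
  have lead i := leadingP _ _ (proj2 (andP (svalP (exv i)))).
  rewrite -unitmx_tr unitmxE det_trig.
    rewrite unitfE prodf_seq_neq0; apply/allP=> i _ /=.
    by rewrite mxE PSE; case: (lead i).
  apply/is_trig_mxP=> i j lt_ij; rewrite mxE PSE.
  by case: (lead j) => _; apply; rewrite ltn_enum_valE.
have VS_full : row_full (V *m S^T).
  rewrite -sub1mx -(mulVmx PS_unit) mulmxA; apply/submxMr.
  by apply: mulmx_sub.
(* Since [V *m S^T] has full column rank, [pinvmx] is a left inverse of it, and the pivot columns of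
   [B] form the identity. *)
pose B := pinvmx (V *m S^T) *m V.
have BS : B *m S^T = 1%:M by rewrite -mulmxA mulVpmx.
have BV : (B <= V)%MS by apply: submxMl.
clearbody B.
exists B; last first.
  apply/eqmxP; rewrite BV; apply/row_subP=> i; rewrite -[row i V]subr0.
  (* Subtracting the combination of rows of [B] with the same pivot entries leaves a vector of [V]
     that vanishes at all pivots. *)
  suff <- : row i V - row i V *m S^T *m B = 0 by rewrite opprB addrC subrK submxMl.
  apply: V0; last by rewrite mulmxBl -!mulmxA BS mulmx1 subrr.
  by rewrite addmx_sub ?row_sub // eqmx_opp mulmx_sub.
split=> // i j lt_ji.
(* Row [i] of [B] leads in some column of [D], and its only nonzero entry there is at its own
   pivot. *)
have /ex_leading[t Bt] : row i B != 0.
  apply/rV0Pn; exists (enum_val i).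
  by rewrite mxE -mul_tr_piv_mxE BS mxE eqxx oner_eq0.
have Dt : t \in D.
  by apply/lead_setP; exists (row i B) => //; apply: submx_trans (row_sub _ _) BV.
have [k deft] := enum_val_surj Dt; case/leadingP: Bt => Bt B0.
have := B0 j; rewrite mxE; apply; move: Bt.
rewrite deft mxE -mul_tr_piv_mxE BS mxE.
by have [<-|] := eqVneq i k; rewrite ?eqxx.
Qed.

(** Each subspace with pivots [D] has exactly one reduced echelon basis, so bases can be counted
    instead of subspaces. *)
Lemma card_subspaces_pivots (D : {set 'I_n}) (P : pred 'M[F]_n) :
  #|[set W in subspaces F n | has_pivots W D && P W]| =
  #|[set B : 'M[F]_(#|D|, n) | rref_with_pivots B (fun i => enum_val i) && P <<B>>%MS]|.
Proof.
rewrite -[RHS](card_in_imset (f := fun B => <<B>>%MS)) => [|B B'].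
  apply: eq_card => W; rewrite !inE; apply/idP/imsetP => [/and3P[/eqP genW /existsP[B]]|[B]].
    case/andP=> Br /eqmxP BW PW; have defW : W = <<B>>%MS.
      by rewrite -genW; apply/genmxP/eqmxP/eqmx_sym.
    by exists B => //; rewrite inE Br -defW.
  rewrite inE => /andP[Br PB] ->; rewrite genmx_id eqxx PB andbT /=.
  by apply/existsP; exists B; rewrite Br; apply/eqmxP; apply/eqmx_sym/genmxE.
rewrite !inE => /andP[/rrefP Br _] /andP[/rrefP B'r _] eqB.
have : (B <= <<B'>>)%MS by rewrite -eqB genmxE.
by rewrite genmxE; apply: rref_inj.
Qed.

End FiniteRref.

(** * Krylov spaces *)

Section Krylov.
Variables (F : fieldType) (n : nat).

(** The generating matrix may have any number of rows; [<<_>>] makes the summands square. *)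
Definition krylov (Delta : 'M[F]_n) m (W : 'M[F]_(m, n)) j : 'M[F]_n :=
  (\sum_(i < j) <<W *m Delta ^+ i>>)%MS.

Lemma krylov0 (Delta : 'M[F]_n) m (W : 'M[F]_(m, n)) : krylov Delta W 0 = 0.
Proof. by rewrite /krylov big_ord0. Qed.

Lemma krylovS (Delta : 'M[F]_n) m (W : 'M[F]_(m, n)) j :
  (krylov Delta W j.+1 :=: W + krylov Delta W j *m Delta)%MS.
Proof.
apply: eqmx_trans (adds_eqmx (eqmx_refl _) (eqmx_sym (sumsmxMr _ _ _))).
rewrite /krylov big_ord_recl expr0 mulmx1.
apply: adds_eqmx (genmxE _) _; apply: eqmx_sums => i _.
rewrite lift0 exprSr mulmxA; apply: eqmx_trans (genmxE _) _.
exact/eqmxMr/eqmx_sym/genmxE.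
Qed.

Lemma eqmx_krylov (Delta : 'M[F]_n) m1 m2 (W1 : 'M[F]_(m1, n)) (W2 : 'M[F]_(m2, n)) j :
  (W1 :=: W2)%MS -> (krylov Delta W1 j :=: krylov Delta W2 j)%MS.
Proof. move=> eqW; apply: eqmx_sums => i _; apply: eqmx_trans (genmxE _) _.
apply: eqmx_sym; apply: eqmx_trans (genmxE _) _; exact/eqmxMr/eqmx_sym.
Qed.

Lemma krylov_square (Delta W : 'M[F]_n) j :
  (\sum_(i < j) W *m Delta ^+ i :=: krylov Delta W j)%MS.
Proof. by apply: eqmx_sums => i _; apply/eqmx_sym/genmxE. Qed.

End Krylov.

(** * From subspaces with pivots [C] to supported matrices [Y] *)

Section FirstStep.
Variables (F : finFieldType) (n : nat) (delta : 'I_n -> F) (C : {set 'I_n}).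
Hypothesis delta_inj : injective delta.

Local Notation m := #|C|.
Local Notation Delta := (diag_mx (\row_t delta t)).
Local Notation Delta' := (diag_mx (\row_(t < n - m) delta (phi t))).
Local Notation Phi := (sel_mx F (@phi n C)).
Local Notation S := (piv_mx F C).

Lemma piv_mul_tr_phi : S *m Phi^T = 0.
Proof.
by apply/matrixP=> i t; rewrite mul_tr_sel_mxE !mxE eq_sym enum_val_neq_phi.
Qed.

Lemma phi_mul_tr_piv : Phi *m S^T = 0.
Proof. by rewrite -[Phi]trmxK -trmx_mul piv_mul_tr_phi trmx0. Qed.

Lemma piv_mul_tr : S *m S^T = 1%:M.
Proof. exact/sel_mx_mul_tr/enum_val_inj. Qed.

Lemma phi_mul_tr : Phi *m Phi^T = 1%:M.
Proof. exact/sel_mx_mul_tr/phi_inj. Qed.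

Lemma phi_Delta : Phi *m Delta = Delta' *m Phi.
Proof. by rewrite sel_mx_diag; congr (diag_mx _ *m _); apply/rowP=> t; rewrite !mxE. Qed.

Lemma piv_Delta : S *m Delta = diag_mx (\row_i delta (enum_val i)) *m S.
Proof. by rewrite sel_mx_diag; congr (diag_mx _ *m _); apply/rowP=> t; rewrite !mxE. Qed.

Lemma mx_piv_phi p (M : 'M[F]_(p, n)) : M = M *m S^T *m S + M *m Phi^T *m Phi.
Proof.
apply/matrixP=> i x; rewrite [RHS]mxE.
have [/enum_val_surj[k ->]|/phi_surj[t ->]] := boolP (x \in C).
  rewrite [X in _ + X]mul_sel_mx_out => [|t]; last by rewrite enum_val_neq_phi.
  by rewrite addr0 mul_sel_mxE ?mul_tr_sel_mxE //; apply: enum_val_inj.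
rewrite [X in X + _]mul_sel_mx_out => [|k]; last by rewrite eq_sym enum_val_neq_phi.
by rewrite add0r mul_sel_mxE ?mul_tr_sel_mxE //; apply: phi_inj.
Qed.

(** The echelon condition of the rows, read in the columns outside [C]. *)
Definition supported (Y : 'M[F]_(m, n - m)) :=
  [forall i, forall t, (phi t < @enum_val _ (mem C) i)%N ==> (Y i t == 0)].

Lemma supportedP (Y : 'M[F]_(m, n - m)) :
  reflect (forall (i : 'I_m) t, (phi t < enum_val i)%N -> Y i t = 0) (supported Y).
Proof.
apply: (iffP forallP) => [Y0 i t lt_ti|Y0 i].
  by have /forallP/(_ t) := Y0 i; rewrite lt_ti => /eqP.
by apply/forallP=> t; apply/implyP=> lt_ti; rewrite Y0.
Qed.

Definition gap (i : 'I_m) (t : 'I_(n - m)) : F := delta (phi t) - delta (enum_val i).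

(** This is where distinctness of the diagonal entries enters: [phi t] lies outside [C]. *)
Lemma gap_neq0 i t : gap i t != 0.
Proof. by rewrite subr_eq0 (inj_eq delta_inj) eq_sym enum_val_neq_phi. Qed.

(** The inverse of the passage from X to Y: dividing by the gaps recovers X, and [S] supplies the
    identity in the columns of [C]. *)
Definition mx_of_step (Y : 'M[F]_(m, n - m)) : 'M[F]_(m, n) :=
  S + (\matrix_(i, t) ((gap i t)^-1 * Y i t)) *m Phi.

(* The rows of [Y], placed in the columns outside [C], span [W Delta] modulo [W]. *)
Lemma mx_of_step_Delta Y :
  mx_of_step Y *m Delta
    = diag_mx (\row_i delta (enum_val i)) *m mx_of_step Y + Y *m Phi.
Proof.
rewrite /mx_of_step; set X := \matrix_(i, t) _.
have -> : Y = X *m Delta' - diag_mx (\row_i delta (enum_val i)) *m X.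
  apply/matrixP=> i t; rewrite mxE mul_mx_diag [in RHS]mxE [X in _ + X]mxE mul_diag_mx !mxE.
  by rewrite [_ * delta _]mulrC -mulrBl -/(gap i t) mulrA divff ?gap_neq0 ?mul1r.
rewrite mulmxDl mulmxDr mulmxBl piv_Delta -!mulmxA phi_Delta -addrA; congr (_ + _).
by rewrite addrC subrK.
Qed.

(** Induction on [j]: [krylovS] applies [Delta] once more, [phi_Delta] moves it past [Phi] as
    [Delta'], and [mx_of_step_Delta] handles the new generators. *)
Lemma mx_of_step_krylov Y j :
  (krylov Delta (mx_of_step Y) j.+1 :=: mx_of_step Y + krylov Delta' Y j *m Phi)%MS.
Proof.
elim: j => [|j IHj].
  apply: eqmx_trans (krylovS _ _ _) _; rewrite !krylov0 !mul0mx.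
  exact/(adds_eqmx (eqmx_refl _))/eqmx_sym/eqmx0.
apply: eqmx_trans (krylovS _ _ _) _.
set B := mx_of_step Y in IHj *.
have KD : (krylov Delta B j.+1 *m Delta :=: B *m Delta + krylov Delta' Y j *m Delta' *m Phi)%MS.
  apply: eqmx_trans (eqmxMr _ IHj) _; apply: eqmx_trans (addsmxMr _ _ _) _.
  by rewrite -!mulmxA phi_Delta; apply: eqmx_refl.
have KP : (krylov Delta' Y j.+1 *m Phi :=: Y *m Phi + krylov Delta' Y j *m Delta' *m Phi)%MS.
  by apply: eqmx_trans (eqmxMr _ (krylovS _ _ _)) _; apply: addsmxMr.
apply: eqmx_trans (adds_eqmx (eqmx_refl _) KD) _.
apply: eqmx_sym; apply: eqmx_trans (adds_eqmx (eqmx_refl _) KP) _.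
rewrite !addsmxA; apply: adds_eqmx (eqmx_refl _).
(* What remains is that [B *m Delta] and [Y *m Phi] agree modulo the rows of [B]. *)
apply/eqmxP; rewrite !addsmx_sub !addsmxSl /=.
have YE : Y *m Phi = - (diag_mx (\row_i delta (enum_val i)) *m B) + B *m Delta.
  by rewrite mx_of_step_Delta addKr.
apply/andP; split; first by rewrite YE addmx_sub_adds // eqmx_opp submxMl.
by rewrite [B *m _]mx_of_step_Delta addmx_sub_adds ?submxMl.
Qed.

Lemma mx_of_step_piv Y : mx_of_step Y *m S^T = 1%:M.
Proof. by rewrite mulmxDl -mulmxA phi_mul_tr_piv mulmx0 addr0 piv_mul_tr. Qed.

(** Restriction to the columns of [C] is the identity on [mx_of_step Y] and kills [Z *m Phi], so the
    sum is direct. *)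
Lemma rank_mx_of_step Y p (Z : 'M[F]_(p, n - m)) :
  \rank (mx_of_step Y + Z *m Phi)%MS = (m + \rank Z)%N.
Proof.
rewrite mxrank_disjoint_sum.
  rewrite mxrankMfree ?row_free_sel_mx //; last exact: phi_inj.
  congr (_ + _)%N; apply/eqP; apply/row_freeP; exists S^T; exact: mx_of_step_piv.
apply/eqP; rewrite -submx0; apply/rV_subP=> v; rewrite sub_capmx => /andP[/submxP[u ->]].
case/submxP=> w /(congr1 (mulmx^~ S^T)).
by rewrite -!mulmxA mx_of_step_piv phi_mul_tr_piv !mulmx0 mulmx1 => ->; rewrite mul0mx sub0mx.
Qed.

Lemma krylov_dim_mx_of_step Y j :
  krylov_dim Delta <<mx_of_step Y>>%MS j.+1 = (m + krylov_dim Delta' <<Y>>%MS j)%N.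
Proof.
rewrite /krylov_dim !krylov_square.
rewrite (eqmx_krylov _ _ (genmxE _)) (eqmx_krylov _ _ (genmxE _)).
by rewrite mx_of_step_krylov rank_mx_of_step.
Qed.

(** By [krylov_dim_mx_of_step] both sides of each dimension condition lose [m], the first part of
    [mu], and the index drops by one. *)
Lemma has_profile_mx_of_step mu Y : (0 < size mu)%N -> m = nth 0%N mu 0 ->
  has_profile Delta mu <<mx_of_step Y>>%MS = has_profile Delta' (behead mu) <<Y>>%MS.
Proof.
case: mu => // a mu _ /= defa; rewrite /has_profile /= !krylov_dim_mx_of_step eqn_add2l.
congr (_ && _); apply/forallP/forallP=> prof j.
  have := prof (lift ord0 j); by rewrite lift0 krylov_dim_mx_of_step /= -defa eqn_add2l.
(* The condition at [ord0] has no counterpart for [Y]; it says that [m] is the first part. *)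
have [k ->|->] := unliftP ord0 j; last first.
  by rewrite krylov_dim_mx_of_step /= take0 /= addn0 /krylov_dim big_ord0 mxrank0 addn0 -defa.
by rewrite lift0 krylov_dim_mx_of_step /= -defa eqn_add2l.
Qed.

Lemma mx_of_step_inj : injective mx_of_step.
Proof.
move=> Y Y' /addrI /(congr1 (mulmx^~ Phi^T)).
rewrite -!mulmxA phi_mul_tr !mulmx1 => /matrixP eqY; apply/matrixP=> i t.
by have := eqY i t; rewrite !mxE => /mulfI; apply; rewrite invr_eq0 gap_neq0.
Qed.

Lemma mx_of_stepE Y i x : mx_of_step Y i (enum_val x) = (i == x)%:R.
Proof. by rewrite -mul_tr_piv_mxE mx_of_step_piv mxE. Qed.

Lemma mx_of_step_phi Y i t : mx_of_step Y i (phi t) = (gap i t)^-1 * Y i t.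
Proof.
by rewrite mxE mul_sel_mxE ?mxE ?[phi t == _]eq_sym ?enum_val_neq_phi ?add0r //; apply: phi_inj.
Qed.

Lemma rref_mx_of_step Y : rref (mx_of_step Y) <-> supported Y.
Proof.
split=> [[B0 _]|/supportedP Y0].
  apply/supportedP=> i t /B0 /eqP; rewrite mx_of_step_phi mulf_eq0 invr_eq0.
  by rewrite (negPf (gap_neq0 _ _)) => /eqP.
split=> [i x|]; last exact: mx_of_step_piv.
have [/enum_val_surj[k ->]|/phi_surj[t ->]] := boolP (x \in C).
  by rewrite mx_of_stepE; case: eqP => // ->; rewrite ltnn.
by move=> lt_ti; rewrite mx_of_step_phi Y0 ?mulr0.
Qed.

Lemma rref_mx_of_step_surj (B : 'M[F]_(m, n)) : rref B -> exists Y, B = mx_of_step Y.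
Proof.
case=> _ B1; exists (\matrix_(i, t) (gap i t * B i (phi t))).
rewrite [LHS]mx_piv_phi B1 mul1mx; congr (_ + _ *m _).
by apply/matrixP=> i t; rewrite !mxE mulKf ?gap_neq0 // -mul_tr_sel_mxE mxE.
Qed.

Lemma sigma_supported mu : (0 < size mu)%N -> m = nth 0%N mu 0 ->
  sigma Delta C mu =
  #|[set Y | supported Y && has_profile Delta' (behead mu) <<Y>>%MS]|.
Proof.
move=> mu0 defm; rewrite /sigma card_subspaces_pivots.
rewrite -[RHS](card_imset _ mx_of_step_inj); apply: eq_card => B.
rewrite !inE; apply/andP/imsetP=> [[/rrefP Br Bp]|[Y]].
  have [Y defB] := rref_mx_of_step_surj Br; exists Y => //.
  by rewrite inE -has_profile_mx_of_step // -defB Bp andbT; apply/rref_mx_of_step; rewrite -defB.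
rewrite inE -(has_profile_mx_of_step _ mu0 defm) => /andP[/rref_mx_of_step Yr Yp] ->.
by split=> //; apply/rrefP.
Qed.

End FirstStep.

(** * Counting full-rank matrices with staircase support *)

Section FerrersMatrices.
Variables (F : finFieldType) (m : nat).
Local Notation q := #|F|.

Lemma card_row_space p (U : 'M[F]_(p, m)) :
  #|[set v : 'rV[F]_m | (v <= U)%MS]| = (q ^ \rank U)%N.
Proof.
have inj : injective (fun u : 'rV_(\rank U) => u *m row_base U).
  exact/row_free_inj/row_base_free.
have <- : #|{: 'rV[F]_(\rank U)}| = (q ^ \rank U)%N by rewrite card_mx mul1n.
rewrite -cardsT -(card_imset _ inj); apply: eq_card => v; rewrite inE.
rewrite -(eq_row_base U); apply/submxP/imsetP=> -[u]; first by exists u.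
by exists u.
Qed.

(** The row space of [pid_mx h] is the span of the first [h] coordinate vectors; this turns a
    support condition into membership in a subspace of known size. *)
Lemma sub_pid_mxP h (v : 'rV[F]_m) :
  reflect (forall j : 'I_m, (h <= j)%N -> v 0 j = 0) (v <= (pid_mx h : 'M_m))%MS.
Proof.
apply: (iffP submxP) => [[u ->] j le_hj|v0].
  by rewrite mxE big1 // => i _; rewrite mxE; case: eqP => [->|]; rewrite ?ltnNge ?le_hj mulr0.
exists v; apply/rowP=> j; rewrite mxE (bigD1 j) //= big1 ?addr0 => [|i neq_ij].
  rewrite mxE eqxx /=; have [le_hj|lt_jh] := leqP h j; last by rewrite mulr1.
  by rewrite v0 // mul0r.
by rewrite mxE (negPf (neq_ij : val i != val j)) mulr0.
Qed.

Lemma row_free_col_mx p (U : 'M[F]_(p, m)) (v : 'rV[F]_m) :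
  row_free (col_mx U v) = row_free U && ~~ (v <= U)%MS.
Proof.
rewrite /row_free -addsmxE; have [vU|nvU] := boolP (v <= U)%MS.
  rewrite (addsmx_idPl vU) andbF addn1; apply/negbTE.
  by rewrite neq_ltn ltnS rank_leq_row.
rewrite mxrank_disjoint_sum.
  rewrite rank_rV (_ : v != 0) ?eqn_add2r ?andbT //.
  by apply: contraNneq nvU => ->; apply: sub0mx.
apply/eqP; rewrite -mxrank_eq0 -leqn0 -ltnS.
(* The intersection is a proper subspace of the span of [v], which has dimension at most 1. *)
have lt_cap : (U :&: v < v)%MS by rewrite ltmxE capmxSr sub_capmx submx_refl andbT.
apply: leq_trans (rank_ltmx lt_cap) _ => //; exact: rank_leq_row.
Qed.

Definition ferrers r (h : nat -> nat) (A : 'M[F]_(r, m)) :=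
  [forall i : 'I_r, forall j : 'I_m, (h i <= j)%N ==> (A i j == 0)].

Lemma ferrersP r (h : nat -> nat) (A : 'M[F]_(r, m)) :
  reflect (forall i : 'I_r, (row i A <= (pid_mx (h i) : 'M_m))%MS) (ferrers h A).
Proof.
apply: (iffP forallP) => A0 i.
  apply/sub_pid_mxP=> j le_hj; rewrite mxE; have /forallP/(_ j) := A0 i.
  by rewrite le_hj => /eqP.
apply/forallP=> j; apply/implyP=> le_hj; have /sub_pid_mxP/(_ j le_hj) := A0 i.
by rewrite mxE => ->.
Qed.

(** The rows are chosen one at a time: row i lies in a space of dimension [h i] and must avoid the
    span of the i earlier rows, which that space contains because [h] is monotone. *)
Lemma card_row_free_ferrers r (h : nat -> nat) :
    (forall i j, i <= j < r -> h i <= h j)%N -> (forall i, i < r -> h i <= m)%N ->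
  #|[set A : 'M[F]_(r, m) | row_free A && ferrers h A]|
    = (\prod_(i < r) (q ^ h i - q ^ i))%N.
Proof.
elim: r => [|r IHr] h_mono h_le.
  have <- : #|{: 'M[F]_(0, m)}| = (\prod_(i < 0) (q ^ h i - q ^ i))%N.
    by rewrite card_mx big_ord0.
  rewrite -cardsT; apply: eq_card => A; rewrite !inE [row_free A]/row_free.
  by rewrite -leqn0 rank_leq_row; apply/forallP=> -[].
rewrite big_ord_recr /= -{}IHr; first last.
- by move=> i lt_ir; apply: h_le; apply: ltnW.
- by move=> i j /andP[le_ij lt_jr]; apply: h_mono; rewrite le_ij ltnW.
set SA := [set A : 'M_(r, m) | _].
rewrite -[r.+1]addn1.
pose row_set (U : 'M[F]_(r, m)) :=
  [set v : 'rV[F]_m | (v <= (pid_mx (h r) : 'M_m))%MS && ~~ (v <= U)%MS].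
have -> : #|[set A : 'M[F]_(r + 1, m) | row_free A && ferrers h A]| =
    (\sum_(U in SA) #|row_set U|)%N.
  rewrite -sum1dep_card (reindex (fun p : 'M_(r, m) * 'rV_m => col_mx p.1 p.2)) /=; last first.
    exists (fun A => (usubmx A, dsubmx A)) => [[U v]|A] _ /=; last exact: vsubmxK.
    by rewrite col_mxKu col_mxKd.
  rewrite [RHS](eq_bigr (fun U => \sum_(v in row_set U) 1)%N); last first.
    by move=> U _; rewrite sum1_card.
  rewrite pair_big_dep /=; apply: eq_bigl => -[U v] /=.
  rewrite row_free_col_mx !inE -!andbA; congr (_ && _).
  rewrite andbC andbA; congr (_ && _).
  apply/ferrersP/andP=> [fer|[/ferrersP fer vh] i].
    split.
      by apply/ferrersP=> i; have := fer (lshift 1 i); rewrite rowKu.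
    by have := fer (rshift r 0); rewrite rowKd row_id /= addn0.
  case: (fintype.splitP i) => k defi.
    by rewrite (_ : i = lshift 1 k) ?rowKu ?fer //; apply: val_inj.
  rewrite (_ : i = rshift r 0) ?rowKd ?row_id /= ?addn0 //; apply: val_inj.
  by rewrite /= defi ord1.
(* The number of choices for the last row is the same for every [U] in [SA]. *)
rewrite (eq_bigr (fun=> q ^ h r - q ^ r)%N) ?sum_nat_const // => U.
rewrite inE => /andP[Ufree /ferrersP Ufer].
have Uh : (U <= (pid_mx (h r) : 'M_m))%MS.
  apply/row_subP=> i; apply/sub_pid_mxP=> j le_hj; have /sub_pid_mxP := Ufer i; apply.
  by apply: leq_trans le_hj; apply: h_mono; rewrite ltnW /=.
have <- : #|[set v : 'rV[F]_m | (v <= U)%MS]| = (q ^ r)%N.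
  by rewrite card_row_space (eqP Ufree).
have <- : #|[set v : 'rV[F]_m | (v <= (pid_mx (h r) : 'M_m))%MS]| = (q ^ h r)%N.
  by rewrite card_row_space rank_pid_mx ?h_le.
rewrite -cardsDS.
  by apply: eq_card => v; rewrite !inE andbC.
by apply/subsetP=> v; rewrite !inE => /submx_trans; apply.
Qed.

End FerrersMatrices.

(** A down-closed set contains 0, ..., i if it contains i, and otherwise lies in 0, ..., i-1;
    compare cardinalities. *)
Lemma downset_ord m (P : pred 'I_m) (i : 'I_m) :
  (forall i j : 'I_m, i <= j -> P j -> P i)%N -> P i = (i < #|P|)%N.
Proof.
move=> Pdown; have cardlt (k : nat) : (k <= m)%N -> #|[pred j : 'I_m | j < k]%N| = k.
  move=> le_km; rewrite -sum1_card -(big_ord_widen _ (fun=> 1%N) le_km) /=.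
  by rewrite sum1_card card_ord.
apply/idP/idP=> [Pi|].
  rewrite -[i.+1](cardlt i.+1) ?ltn_ord //; apply/subset_leq_card/subsetP=> j.
  by rewrite inE ltnS => le_ji; apply: Pdown Pi.
apply: contraLR => nPi; rewrite -leqNgt -[val i](cardlt i (ltnW (ltn_ord i))).
apply/subset_leq_card/subsetP=> j; rewrite inE => Pj; rewrite ltnNge.
by apply: contraNN nPi => le_ij; apply: Pdown Pj.
Qed.

(** * Factoring supported matrices through reduced echelon bases *)

Section SecondStep.
Variables (F : finFieldType) (n : nat) (C : {set 'I_n}).
Local Notation m := #|C|.
Implicit Type D : {set 'I_(n - m)}.

Definition supported_on (D : {set 'I_(n - m)}) (A : 'M[F]_(m, #|D|)) :=
  [forall i : 'I_m, forall j : 'I_#|D|,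
    (phi (enum_val j) < (enum_val i : 'I_n))%N ==> (A i j == 0)].

Lemma supported_onP D (A : 'M[F]_(m, #|D|)) :
  reflect (forall (i : 'I_m) (j : 'I_#|D|),
    (phi (enum_val j) < (enum_val i : 'I_n))%N -> A i j = 0) (supported_on A).
Proof.
apply: (iffP forallP) => [A0 i j lt_ji|A0 i].
  by have /forallP/(_ j) := A0 i; rewrite lt_ji => /eqP.
by apply/forallP=> j; apply/implyP=> lt_ji; rewrite A0.
Qed.

(** The pivot columns of [A *m R] are the columns of [A]. Conversely column [t] of the product only
    involves rows of [R] with pivot at most [t], where the condition on [A] is at least as
    strong. *)
Lemma supported_mul D (A : 'M[F]_(m, #|D|)) (R : 'M[F]_(#|D|, n - m)) :
  rref R -> supported (A *m R) = supported_on A.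
Proof.
move=> [R0 R1]; apply/supportedP/supported_onP=> A0 i t lt_ti.
  rewrite -[A]mulmx1 -R1 mulmxA mul_tr_piv_mxE; exact: A0.
rewrite mxE big1 // => j _; have [lt_tj|le_jt] := ltnP t (enum_val j).
  by rewrite R0 ?mulr0.
rewrite A0 ?mul0r //; apply: leq_ltn_trans lt_ti.
by rewrite leqNgt ltn_phiE -leqNgt.
Qed.

Definition coef_mxs (D : {set 'I_(n - m)}) : {set 'M[F]_(m, #|D|)} :=
  [set A | row_full A && supported_on A].

(** Sort the [Y] by the pivots [D] of their row space; each is uniquely [A *m R] with [R] its
    reduced echelon basis and [A] of full column rank. *)
Lemma card_supported (Delta' : 'M[F]_(n - m)) nu :
  #|[set Y : 'M[F]_(m, n - m) | supported Y && has_profile Delta' nu <<Y>>%MS]| =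
  (\sum_D #|coef_mxs D| * sigma Delta' D nu)%N.
Proof.
rewrite -sum1dep_card (partition_big (fun Y : 'M_(m, n - m) => lead_set Y) predT) //=.
apply: eq_bigr => D _; rewrite /sigma card_subspaces_pivots -cardsX sum1dep_card.
have eq_gen (A : 'M[F]_(m, #|D|)) (R : 'M[F]_(#|D|, n - m)) :
    row_full A -> (A *m R :=: R)%MS by move=> fA; apply: eqmxMfull.
rewrite -[RHS](card_in_imset (f := fun p : 'M_(m, #|D|) * 'M_(#|D|, n - m) => p.1 *m p.2)).
  apply: eq_card => Y; rewrite !inE; apply/idP/imsetP.
    case/andP=> /andP[Ysupp Yprof] /eqP defD.
    have [R Rr RY] := ex_rref Y; move: R Rr RY; rewrite defD => R Rr RY.
    have /submxP[A defY] : (Y <= R)%MS by rewrite RY.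
    exists (A, R) => //; rewrite !inE /= -(supported_mul _ Rr) -defY Ysupp /=.
    rewrite (eq_genmx RY) Yprof !andbT; apply/andP; split; last exact/rrefP.
    (* The rank of [A] is at least that of [A *m R], which is [#|D|]. *)
    rewrite /row_full eqn_leq rank_leq_col /= -{1}(eqP (rref_row_free Rr)) RY defY.
    exact: mxrankM_maxl.
  case=> -[A R]; rewrite !inE /= => /andP[/andP[fA Asupp] /andP[/rrefP Rr Rprof]] ->.
  rewrite supported_mul // Asupp (eq_lead_set (eq_gen _ _ fA)) rref_lead_set // eqxx andbT.
  by rewrite (eq_genmx (eq_gen _ _ fA)).
move=> [A R] [A' R']; rewrite !inE /=.
move=> /andP[/andP[fA _] /andP[/rrefP Rr _]] /andP[/andP[fA' _] /andP[/rrefP R'r _]] eqY.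
have eqR : R = R'.
  have : (R <= A' *m R')%MS by rewrite -eqY (eq_gen _ _ fA).
  by rewrite (eq_gen _ _ fA'); apply: rref_inj.
by congr (_, _) => //; case: Rr => _ R1; rewrite -[A]mulmx1 -[A']mulmx1 -R1 !mulmxA eqY eqR.
Qed.

(** The number h_j of the overview. The index is a natural number, as [ferrers] expects; past the
    end the default 0 gives height 0. *)
Definition height (D : {set 'I_(n - m)}) (k : nat) : nat :=
  #|[pred i : 'I_m | (enum_val i : 'I_n) < nth 0 [seq val (phi t) | t <- enum D] k]%N|.

Lemma heightE D (j : 'I_#|D|) :
  height D j = #|[pred i : 'I_m | (enum_val i : 'I_n) < phi (enum_val j)]%N|.
Proof.
have x0 := enum_val j; apply: eq_card => i; rewrite !inE; congr (_ < _)%N.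
by rewrite (nth_map x0) -?cardE // (enum_val_nth x0).
Qed.

Lemma height_ltnE D (i : 'I_m) (j : 'I_#|D|) :
  ((enum_val i : 'I_n) < phi (enum_val j))%N = (i < height D j)%N.
Proof.
rewrite heightE -downset_ord // => k l le_kl /=; apply: leq_ltn_trans.
by rewrite leqNgt ltn_enum_valE -leqNgt.
Qed.

(** Transposing turns the columns of [A] into rows of staircase shape with lengths [height D j]. *)
Lemma card_coef_mxs D :
  #|coef_mxs D| = (\prod_(j < #|D|) (#|F| ^ height D j - #|F| ^ j))%N.
Proof.
rewrite -(card_row_free_ferrers F (m := m)).
- rewrite -[LHS](card_imset _ (@trmx_inj _ _ _)); apply: eq_card => A; rewrite [RHS]inE.
  have suppE (B : 'M[F]_(m, #|D|)) : supported_on B = ferrers (height D) B^T.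
    have hE (i : 'I_m) (j : 'I_#|D|) :
        (phi (enum_val j) < (enum_val i : 'I_n))%N = (height D j <= i)%N.
      by rewrite ltn_phi_enum_val height_ltnE -leqNgt.
    apply/forallP/forallP=> B0 i; apply/forallP=> j.
      by have /forallP/(_ i) := B0 j; rewrite mxE hE.
    by have /forallP/(_ i) := B0 j; rewrite mxE hE.
  apply/imsetP/andP=> [[B]|[fA hA]].
    by rewrite inE => /andP[fB sB] ->; rewrite -suppE /row_free mxrank_tr.
  by exists A^T; rewrite ?trmxK // inE suppE trmxK hA /row_full mxrank_tr andbT.
- move=> i j /andP[le_ij lt_jD]; have lt_iD := leq_ltn_trans le_ij lt_jD.
  rewrite (heightE (Ordinal lt_iD)) (heightE (Ordinal lt_jD)).
  apply/subset_leq_card/subsetP=> k; rewrite !inE => /leq_trans; apply.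
  by rewrite leqNgt ltn_phiE ltn_enum_valE -leqNgt.
by move=> i _; rewrite -[X in (_ <= X)%N]card_ord; apply: max_card.
Qed.

End SecondStep.

Local Open Scope nat_scope.

(** * Tableaux with two columns *)

Section TwoColumns.
Variables (a b : seq nat).
Hypothesis le_ba : size b <= size a.
Local Notation T := [:: a; b].

Lemma nrows2 : nrows T = size a.
Proof. by rewrite /nrows !big_cons big_nil maxn0; apply/maxn_idPl. Qed.

Lemma trow2 i : i < size a ->
  trow T i = if i < size b then [:: nth 0 a i; nth 0 b i] else [:: nth 0 a i].
Proof. by rewrite /trow /= => ->; case: ifP. Qed.

Lemma cq2 q : cq q T = \prod_(i < size b) qint q (c_stat T i 1).
Proof.
rewrite /cq nrows2 big_mkord.
(* Rows of length 1 contribute an empty product, longer ones the single factor [j = 1]. *)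
have -> : \prod_(i < size a) \prod_(1 <= j < size (trow T i)) qint q (c_stat T i j)
    = \prod_(i < size a | i < size b) qint q (c_stat T i 1).
  rewrite [RHS]big_mkcond; apply: eq_bigr => i _; rewrite trow2 //.
  by case: ifP => _ /=; [rewrite big_nat1 | rewrite big_geq].
by rewrite (big_ord_widen _ (fun i => qint q (c_stat T i 1)) le_ba).
Qed.

Lemma c_stat2 i :
  c_stat T i 1 = count (fun i' => nth 0 a i' < nth 0 b i) (index_iota i (size a)).
Proof.
rewrite /c_stat nrows2; apply: eq_in_count => i'.
by rewrite mem_index_iota /has_cell /entry /tcol /= => /andP[_ ->].
Qed.

Lemma multilinear2 : all (leq 1) (a ++ b) -> uniq (a ++ b) ->
    sorted ltn a -> sorted ltn b ->
  multilinear_tableau T = [forall i : 'I_(size b), nth 0 a i < nth 0 b i].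
Proof.
move=> pos un sa sb; rewrite /multilinear_tableau /= cats0 le_ba pos un sa sb nrows2 /=.
rewrite !andbT; apply/allP/forallP=> rows i.
  have lt_ia := leq_trans (ltn_ord i) le_ba.
  have := rows i; rewrite mem_iota lt_ia trow2 // ltn_ord /= andbT; exact.
rewrite mem_iota => /andP[_ lt_ia]; rewrite trow2 //; case: ifP => //= lt_ib.
by rewrite andbT; apply: (rows (Ordinal lt_ib)).
Qed.

End TwoColumns.

(** * The entries of T(C, D) *)

Lemma sorted_val_enum n (A : {set 'I_n}) : sorted ltn [seq val x | x <- enum A].
Proof.
rewrite sorted_map /enum_mem; apply: sorted_filter.
  by move=> x y z; apply: ltn_trans.
by have := iota_ltn_sorted 0 n; rewrite -val_enum_ord sorted_map enumT.
Qed.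

Lemma sorted_labels n (A : {set 'I_n}) : sorted ltn (labels A).
Proof.
by have := sorted_val_enum A; rewrite !sorted_map.
Qed.

Lemma size_labels n (A : {set 'I_n}) : size (labels A) = #|A|.
Proof. by rewrite size_map cardE. Qed.

Lemma nth_labels n (A : {set 'I_n}) (i : 'I_#|A|) :
  nth 0 (labels A) i = (val (enum_val i)).+1.
Proof.
have x0 := enum_val i.
by rewrite (nth_map x0) -?cardE // (enum_val_nth x0).
Qed.

(** Both lists are strictly increasing, as [phi] preserves order, and have the same members. *)
Lemma labels_phi n (C : {set 'I_n}) (D : {set 'I_(n - #|C|)}) :
  labels (@phi n C @: D) = [seq (val (phi t)).+1 | t <- enum D].
Proof.
apply: (irr_sorted_eq ltn_trans ltnn); first exact: sorted_labels.
  have := sorted_val_enum D; rewrite !sorted_map; apply: sub_sorted => s t /=.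
  by rewrite ltnS ltn_phiE.
move=> x; apply/mapP/mapP=> -[y]; rewrite mem_enum.
  by case/imsetP=> t Dt -> ->; exists t; rewrite ?mem_enum.
by move=> Dy ->; exists (phi y); rewrite // mem_enum imset_f.
Qed.

Lemma nth_labels_phi n (C : {set 'I_n}) (D : {set 'I_(n - #|C|)}) (j : 'I_#|D|) :
  nth 0 (labels (@phi n C @: D)) j = (val (phi (enum_val j))).+1.
Proof.
have x0 := enum_val j.
by rewrite labels_phi (nth_map x0) -?cardE // (enum_val_nth x0).
Qed.

Lemma count_iota_lt i h m : h <= m -> count (fun k => k < h) (index_iota i m) = h - i.
Proof.
move=> le_hm; rewrite -sum1_count -(big_nat_widen _ _ _ xpredT _ le_hm).
by rewrite sum_nat_const_nat muln1.
Qed.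

(** * Tableau statistics in terms of heights *)

Section Tableau.
Variables (n : nat) (C : {set 'I_n}) (D : {set 'I_(n - #|C|)}).
Hypothesis le_DC : #|D| <= #|C|.

Lemma size_labels_phi : size (labels (@phi n C @: D)) = #|D|.
Proof. by rewrite size_labels card_imset //; apply: phi_inj. Qed.

Let le_sizes : size (labels (@phi n C @: D)) <= size (labels C).
Proof. by rewrite size_labels_phi size_labels. Qed.

Lemma height_le j : height D j <= #|C|.
Proof. by rewrite -[leqRHS]card_ord; apply: max_card. Qed.

Lemma labels_ltnE i (j : 'I_#|D|) : i < #|C| ->
  (nth 0 (labels C) i < nth 0 (labels (@phi n C @: D)) j) = (i < height D j).
Proof.
move=> lt_iC; have := nth_labels (Ordinal lt_iC); rewrite nth_labels_phi /= => ->.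
by rewrite ltnS (height_ltnE (Ordinal lt_iC)).
Qed.

(** The entries of [C] below the j-th entry of the second column occupy rows 0 to [height D j - 1];
    the count starts at row [j]. *)
Lemma c_stat_TCD (j : 'I_#|D|) : c_stat (TCD D) j 1 = height D j - j.
Proof.
rewrite c_stat2 // -(count_iota_lt _ (height_le j)) size_labels.
by apply: eq_in_count => i; rewrite mem_index_iota => /andP[_ /labels_ltnE->].
Qed.

Lemma cq_TCD q : cq q (TCD D) = \prod_(j < #|D|) qint q (height D j - j).
Proof.
rewrite cq2 // size_labels_phi.
by apply: eq_bigr => j _; rewrite -[in RHS]c_stat_TCD.
Qed.

Lemma multilinear_TCD :
  multilinear_tableau (TCD D) = [forall j : 'I_#|D|, j < height D j].
Proof.
rewrite multilinear2 ?sorted_labels //.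
- rewrite size_labels_phi; apply: eq_forallb => j.
  by rewrite labels_ltnE // (leq_trans _ le_DC).
- by rewrite all_cat; apply/andP; split; apply/allP=> x /mapP[y _ ->].
rewrite cat_uniq !(sorted_uniq ltn_trans ltnn) ?sorted_labels //= andbT.
apply/hasPn=> x /mapP[y]; rewrite mem_enum => /imsetP[t _ ->] ->.
apply/mapP=> -[z]; rewrite mem_enum => Cz [/val_inj eqz].
by move: (phi_notin t); rewrite eqz Cz.
Qed.

Lemma prod_height q : 0 < q ->
  \prod_(j < #|D|) (q ^ height D j - q ^ j) =
  if multilinear_tableau (TCD D)
  then (q - 1) ^ #|D| * q ^ 'C(#|D|, 2) * cq q (TCD D) else 0.
Proof.
move=> q_gt0; rewrite multilinear_TCD cq_TCD; case: ifPn => [/forallP mlt|]; last first.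
  (* If [height D j <= j] for some [j], that truncated difference is 0 and so is the product. *)
  rewrite negb_forall => /existsP[j]; rewrite -leqNgt => le_hj.
  by rewrite (bigD1 j) //= (eqP (_ : q ^ _ - q ^ j == 0)) ?mul0n // subn_eq0 leq_pexp2l.
(* With j < h_j, the factor q^h_j - q^j equals (q-1) q^j [h_j - j]_q; the exponents j add up to the
   binomial coefficient. *)
rewrite (eq_bigr (fun j : 'I_#|D| => (q - 1) * q ^ j * qint q (height D j - j))); last first.
  move=> j _; rewrite -{1}(subnKC (ltnW (mlt j))) expnD -{2}[q ^ j]muln1 -mulnBr.
  by rewrite subn1 predn_exp subn1 mulnCA mulnA.
rewrite !big_split /= prod_nat_const card_ord -expn_sum.
by rewrite -bin2_sum big_mkord.
Qed.

End Tableau.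

(** * Dimension forced by the profile, and the recursion *)

Lemma krylov_dim1 (F : finFieldType) n (Delta W : 'M[F]_n) : krylov_dim Delta W 1 = \rank W.
Proof. by rewrite /krylov_dim big_ord1 expr0 mulmx1. Qed.

Lemma has_profile_rank (F : finFieldType) n (Delta : 'M[F]_n) nu W :
  has_profile Delta nu W -> \rank W = nth 0 nu 0.
Proof.
case: nu => [|a nu] /andP[/forallP prof /eqP stab]; rewrite -(krylov_dim1 Delta).
  by rewrite -stab /krylov_dim big_ord0 mxrank0.
by have /eqP-> := prof ord0; rewrite /= take0 /= addn0.
Qed.

(** Any counted subspace has dimension [#|D|] by its pivots and [nth 0 nu 0] by its profile. *)
Lemma sigma_neq0 (F : finFieldType) n (Delta : 'M[F]_n) D nu :
  sigma Delta D nu != 0 -> #|D| = nth 0 nu 0.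
Proof.
rewrite /sigma -lt0n => /card_gt0P[W]; rewrite !inE => /and3P[_ /existsP[B /andP[Br BW]]].
move/has_profile_rank <-; rewrite -(eqmxP BW); apply/esym/eqP.
exact/rref_row_free/rrefP.
Qed.

Theorem theorem4p18 (F : finFieldType) (q : nat) (hq : #|F| = q)
    (n : nat) (delta : 'I_n -> F) (hdelta : injective delta)
    (mu : seq nat) (mu_nonempty : 0 < size mu)
    (mu_partition : sorted geq mu) (mu_pos : all (fun x => 0 < x) mu)
    (C : {set 'I_n}) (hC : #|C| = nth 0 mu 0) :
  let Delta : 'M[F]_n := diag_mx (\row_t delta t) in
  let Delta' : 'M[F]_(n - #|C|) := diag_mx (\row_t delta (phi t)) in
  let mu2 := nth 0 mu 1 in
  sigma Delta C mu =
    (q - 1) ^ mu2 * q ^ 'C(mu2, 2) *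
    \sum_(D : {set 'I_(n - #|C|)} | (#|D| == mu2) && multilinear_tableau (TCD D))
      cq q (TCD D) * sigma Delta' D (behead mu).
Proof.
move=> Delta Delta' mu2.
have le_mu2 : mu2 <= #|C|.
  by rewrite hC /mu2; case: (mu) mu_partition => [|a [|b s]] //= /andP[].
have q_gt0 : 0 < q by rewrite -hq; apply/card_gt0P; exists 0%R.
rewrite sigma_supported // card_supported big_distrr /= [RHS]big_mkcond /=.
apply: eq_bigr => D _.
have [cardD|] := eqVneq #|D| mu2; last first.
  (* For [D] of the wrong size no subspace is counted, so the term is 0. *)
  move=> neqD; have [->|/sigma_neq0] := eqVneq (sigma Delta' D (behead mu)) 0.
    by rewrite muln0.
  by move=> eqD; case/eqP: neqD; rewrite eqD nth_behead.
(* The case split in [prod_height] removes the [D] for which T(C, D) is not a multilinear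
   tableau. *)
rewrite card_coef_mxs hq prod_height ?cardD //; case: ifP => _; last by rewrite mul0n.
by rewrite !mulnA.
Qed.
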